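(* There is a constant $c>0$ such that for every $n$ there exists a circular-arc graph $G$ on $n$ vertices with $\mathrm{sd}(G)\ge c\sqrt{n}$.
   Context: A circular-arc graph is the intersection graph of a finite family of arcs of a circle (vertices are the arcs, two adjacent iff the arcs intersect). For a graph $G$ and distinct vertices $u,v$, $\mathrm{sd}_G(u,v)$ is the number of vertices other than $u,v$ that are adjacent to exactly one of $u$ and $v$. The symmetric difference of $G$ is $\mathrm{sd}(G)=\max_H \min_{u\ne v\in V(H)} \mathrm{sd}_H(u,v)$, the maximum taken over all induced subgraphs $H$ of $G$ with at least two vertices.
   Formalization: ''For every n'' is restricted to n ≥ 4: for n ≤ 1 the symmetric difference is undefined (no induced subgraph with two vertices), and every graph on 2 or 3 vertices has sd(G) = 0, so the inequality fails there for any c > 0. *)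

(* Defs.v *)
From HB Require Import structures.
From mathcomp Require Import all_boot all_order all_algebra.
From mathcomp Require Import all_classical all_reals all_analysis.

Set Implicit Arguments.
Unset Strict Implicit.
Unset Printing Implicit Defensive.

Import Order.TTheory GRing.Theory Num.Theory.

Record sgraph := SGraph {
  vertex :> finType;
  adj : rel vertex;
  adj_sym : symmetric adj;
  adj_irr : irreflexive adj
}.

Section Induced.
Variables (G : sgraph) (A : {set G}).

Definition induced_adj : rel {x : G | x \in A} :=
  fun x y => adj (val x) (val y).

Lemma induced_adj_sym : symmetric induced_adj.
Proof. by move=> x y; apply: adj_sym. Qed.

Lemma induced_adj_irr : irreflexive induced_adj.
Proof. by move=> x; apply: adj_irr. Qed.

Definition induced : sgraph := SGraph induced_adj_sym induced_adj_irr.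

End Induced.

Definition sd_pair (G : sgraph) (u v : G) : nat :=
  #|[set w : G | [&& w != u, w != v & adj w u (+) adj w v]]|.

(* The default value #|G| is never smaller than any sd_pair u v, so this is the
   true minimum as soon as G has two vertices. *)
Definition min_sd (G : sgraph) : nat :=
  \big[minn/#|G|]_(p : G * G | p.1 != p.2) sd_pair p.1 p.2.

(* Induced subgraphs are given by their vertex sets.  If G has fewer than two
   vertices the range is empty and the value is 0 by convention. *)
Definition sd (G : sgraph) : nat :=
  \max_(A : {set G} | 2 <= #|A|) min_sd (induced A).

Local Open Scope classical_set_scope.
Local Open Scope ring_scope.

(* Arcs are closed arcs of the unit circle, of angular length strictly between
   0 and a full turn; they may pass through the point of angle 0. *)
Definition is_arc (R : realType) (S : set (R * R)) : Prop :=
  exists a b : R, [/\ a < b, b < a + 2 * pi &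
    S = [set (cos t, sin t) | t in [set t | a <= t <= b]]].

Definition circular_arc (R : realType) (G : sgraph) : Prop :=
  exists F : G -> set (R * R),
    (forall v, is_arc (F v)) /\
    (forall u v, u != v -> (adj u v <-> F u `&` F v !=set0)).

(* Main.v *)
(* On a circle with [8 k] grid points take all arcs of length [3 k + s], [s < k],
   starting at a grid point. All arcs are shorter than half of the circle, so the
   gap left by an arc [u] contains, for each of its two ends, the [k] arcs that end
   exactly there, one per length. For distinct [u] and [v], one of the four ends
   of their two gaps lies in the other arc, or close enough to it, so that the [k]
   arcs ending there miss one of [u], [v] and meet the other. As there are [8 k^2]
   arcs, this is of order [sqrt n]; when [k] is too small, an induced path on four
   vertices gives [sd >= 1]. *)
Require Import Defs.
From HB Require Import structures.
From mathcomp Require Import all_boot all_order all_algebra.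
From mathcomp Require Import all_classical all_reals all_analysis.
From mathcomp Require Import zify ring lra.

Import Order.TTheory GRing.Theory Num.Theory.

(** * Lower bounds on [sd] from one induced subgraph *)

Lemma sd_ge (G : sgraph) (A : {set G}) (d : nat) :
  2 <= #|A| ->
  {in A &, forall u v, u != v ->
    d <= #|[set w in A | [&& w != u, w != v & adj w u (+) adj w v]]|} ->
  d <= sd G.
Proof.
move=> A2 dA; apply: leq_trans (leq_bigmax_cond _ A2).
have cardW (x y : Defs.induced A) : sd_pair x y =
    #|[set w in A | [&& w != val x, w != val y & adj w (val x) (+) adj w (val y)]]|.
  rewrite /sd_pair -(card_imset _ val_inj); congr #|pred_of_set _|.
  apply/setP => w; rewrite inE; apply/imsetP/andP => [[z + ->]|[wA wP]].
    by rewrite inE (valP z).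
  by exists (exist _ w wA : Defs.induced A); rewrite ?inE.
rewrite /min_sd; apply: (big_ind (fun m => d <= m)) => [|m n dm dn|[x y] /= xy].
(* The default value [#|induced A|] of the minimum must reach [d] too: it bounds the set counted for
   any one pair. *)
- have /card_gt1P[u [v [uA vA uv]]] := A2.
  apply: leq_trans (dA _ _ uA vA uv) _; rewrite card_sig.
  by apply/subset_leq_card/fintype.subsetP => w; rewrite inE => /andP[].
- by rewrite leq_min dm.
- by rewrite cardW dA ?(valP x) ?(valP y).
Qed.

(* A pair [(a, l)] stands for the arc from [a] to [a + l] on a circle of
   circumference [L]; when [a < L] and [l < L] two such arcs can only meet after
   a shift by [0] or by one full turn in either direction. *)
Definition meets (L : nat) (p q : nat * nat) : bool :=
  [|| (p.1 <= q.1 + q.2) && (q.1 <= p.1 + p.2),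
      q.1 + L <= p.1 + p.2 | p.1 + L <= q.1 + q.2].

Lemma meetsC L p q : meets L p q = meets L q p.
Proof. by rewrite /meets andbC; congr orb; rewrite orbC. Qed.

Section GridGraph.
Variables (L : nat) (V : finType) (f : V -> nat * nat).

Definition grid_adj : rel V := fun u v => (u != v) && meets L (f u) (f v).

Lemma grid_adj_sym : symmetric grid_adj.
Proof. by move=> u v; rewrite /grid_adj eq_sym meetsC. Qed.

Lemma grid_adj_irr : irreflexive grid_adj.
Proof. by move=> u; rewrite /grid_adj eqxx. Qed.

Definition grid_graph : sgraph := SGraph grid_adj_sym grid_adj_irr.

End GridGraph.

(** * Integer grid arcs as arcs of the real circle *)

Section Circle.
Variable R : realType.
Local Open Scope ring_scope.

Lemma sin_eq0_bounded (y : R) : - (pi *+ 2) < y < pi *+ 2 -> sin y = 0 ->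
  [\/ y = - pi, y = 0 | y = pi].
Proof.
have pos (z : R) : 0 < z < pi *+ 2 -> sin z = 0 -> z = pi.
  move=> /andP[z0 z2] sz; have [zp|zp|//] := ltgtP z pi.
    by have := @sin_gt0_pi R z; rewrite z0 zp sz ltxx => /(_ isT).
  have : 0 < sin (z - pi) by apply: sin_gt0_pi; apply/andP; split; lra.
  by rewrite sinB sz cospi sinpi mul0r mulr0 subrr ltxx.
move=> /andP[y1 y2] sy; have [y0|y0|->] := ltgtP y 0; last by constructor 2.
- constructor 1; rewrite -(pos (- y)) ?opprK ?sinN ?sy ?oppr0 //.
  by apply/andP; split; lra.
- by constructor 3; apply: pos; rewrite ?y0.
Qed.

(** The hypotheses give [cos (t - s) = 1], so the sine of [(t - s) / 2] vanishes, and this angle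
    lies strictly between minus and plus one full turn. *)
Lemma cos_sin_eq_bounded (s t : R) : - (pi *+ 4) < t - s < pi *+ 4 ->
  cos t = cos s -> sin t = sin s ->
  [\/ t + pi *+ 2 = s, t = s | t = s + pi *+ 2].
Proof.
move=> /andP[d1 d2] c1 s1.
have s0 : sin ((t - s) / 2) = 0.
  have : cos (((t - s) / 2) *+ 2) = 1.
    rewrite (_ : _ *+ 2 = t - s); last by field.
    by rewrite cosB c1 s1 -!expr2 cos2Dsin2.
  rewrite cos_mulr2n cos2sin2 => e; apply/eqP; rewrite -sqrf_eq0; apply/eqP; lra.
case: (@sin_eq0_bounded ((t - s) / 2)) => // [|h|h|h].
- by apply/andP; split; lra.
- by constructor 1; lra.
- by constructor 2; lra.
- by constructor 3; lra.
Qed.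

Definition grid_arc (L : nat) (p : nat * nat) : set (R * R) :=
  [set (cos t, sin t) | t in
    [set t | p.1%:R * (pi *+ 2 / L%:R) <= t <= (p.1 + p.2)%:R * (pi *+ 2 / L%:R)]]%classic.

Lemma is_arc_grid_arc (L : nat) (p : nat * nat) :
  (0 < p.2)%N -> (p.2 < L)%N -> is_arc (grid_arc L p).
Proof.
move=> l0 lL; have L0 : 0 < L%:R :> R by rewrite ltr0n (leq_trans _ lL).
have p2 : 0 < pi *+ 2 :> R by rewrite pmulrn_lgt0 // pi_gt0.
exists (p.1%:R * (pi *+ 2 / L%:R)), ((p.1 + p.2)%:R * (pi *+ 2 / L%:R)).
split=> //; rewrite natrD (mulrDl p.1%:R).
  by rewrite ltrDl mulr_gt0 ?ltr0n // divr_gt0.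
by rewrite ltrD2l mulrCA [_ * pi]mulr_natl gtr_pMr // ltr_pdivrMr // mul1r ltr_nat.
Qed.

Lemma grid_arc_meets (L : nat) (p q : nat * nat) :
  (p.1 < L)%N -> (p.2 < L)%N -> (q.1 < L)%N -> (q.2 < L)%N ->
  meets L p q <-> (grid_arc L p `&` grid_arc L q !=set0)%classic.
Proof.
move=> pL lp qL lq; rewrite /grid_arc; set h : R := pi *+ 2 / L%:R.
have L0 : 0 < L%:R :> R by rewrite ltr0n (leq_trans _ lp).
have p2 : 0 < pi *+ 2 :> R by rewrite pmulrn_lgt0 // pi_gt0.
have h_gt0 : 0 < h by rewrite divr_gt0.
have hE : L%:R * h = pi *+ 2 by rewrite mulrC divfK // gt_eqF.
have le_h (m n : nat) : (m%:R * h <= n%:R * h) = (m <= n)%N.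
  by rewrite ler_pM2r // ler_nat.
clearbody h.
(* Wrap-around case: the starting point of [b], one full turn later, lies on [a]. *)
have shift (a b : nat * nat) : (b.1 + L <= a.1 + a.2)%N -> (a.1 < L)%N ->
    exists2 t : R, a.1%:R * h <= t + pi *+ 2 <= (a.1 + a.2)%:R * h
                 & b.1%:R * h <= t <= (b.1 + b.2)%:R * h.
  move=> ba aL; exists (b.1%:R * h); last by rewrite !le_h leqnn leq_addr.
  by rewrite -hE -mulrDl -natrD !le_h ba andbT (leq_trans (ltnW aL)) ?leq_addl.
split.
  case/or3P => [/andP[m1 m2]|m|m].
  - exists (cos ((maxn p.1 q.1)%:R * h), sin ((maxn p.1 q.1)%:R * h)).
    by split; exists ((maxn p.1 q.1)%:R * h);
      rewrite //= !le_h ?leq_maxl ?leq_maxr geq_max ?leq_addr ?m1 ?m2.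
  - have [t tp tq] := shift _ _ m pL.
    exists (cos t, sin t); split; last by exists t.
    by exists (t + pi *+ 2); rewrite // cosD2pi sinD2pi.
  - have [t tq tp] := shift _ _ m qL.
    exists (cos t, sin t); split; first by exists t.
    by exists (t + pi *+ 2); rewrite // cosD2pi sinD2pi.
case=> [_ [[t /= tp <-] [s /= sq [cs sn]]]].
(* All angles lie in two turns, so equal points differ by 0 or one turn either way: the three
   clauses of [meets]. *)
have bound (a : nat * nat) (x : R) : (a.1 < L)%N -> (a.2 < L)%N ->
    a.1%:R * h <= x <= (a.1 + a.2)%:R * h -> 0 <= x < pi *+ 4.
  move=> aL al /andP[x1 x2]; apply/andP; split.
    by apply: le_trans x1; rewrite mulr_ge0 // ltW.
  apply: le_lt_trans x2 _.
  have -> : pi *+ 4 = (L + L)%:R * h by rewrite natrD mulrDl hE -mulrnDr.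
  by rewrite ltr_pM2r // ltr_nat -addSn leq_add // ltnW.
have /andP[t0 t4] := bound _ _ pL lp tp.
have /andP[s0 s4] := bound _ _ qL lq sq.
rewrite /meets -!le_h !(natrD _ _ L) !(mulrDl _ L%:R) hE.
have [tp1 tp2] := andP tp; have [sq1 sq2] := andP sq.
have d4 : - (pi *+ 4) < s - t < pi *+ 4.
  clear -t0 t4 s0 s4; apply/andP; split; lra.
case: (cos_sin_eq_bounded _ _ d4 cs sn) => e; apply/or3P.
- constructor 2; clear -e tp2 sq1; lra.
- by constructor 1; rewrite (le_trans tp1) -?e // (le_trans sq1) // e.
- constructor 3; clear -e tp1 sq2; lra.
Qed.

Lemma grid_circular_arc (L : nat) (V : finType) (f : V -> nat * nat) :
  (forall v, [/\ (f v).1 < L, 0 < (f v).2 & (f v).2 < L]%N) ->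
  circular_arc R (grid_graph L V f).
Proof.
move=> fP; exists (fun v => grid_arc L (f v)); split=> [v|u v uv].
  by have [_ ? ?] := fP v; exact: is_arc_grid_arc.
have [? _ ?] := fP u; have [? _ ?] := fP v.
by rewrite -grid_arc_meets //= /grid_adj uv.
Qed.

End Circle.

(* Vertices beyond those of [T] are padding and are left out of the induced
   subgraph that witnesses [sd]. *)
Lemma padded_grid_graph (R : realType) (L n d : nat) (T : finType)
    (f : T -> nat * nat) :
  (1 < #|T| <= n)%N -> (1 < L)%N ->
  (forall v, [/\ (f v).1 < L, 0 < (f v).2 & (f v).2 < L])%N ->
  (forall u v, u != v -> (d <= #|[set w | [&& w != u, w != v &
     meets L (f w) (f u) (+) meets L (f w) (f v)]]|)%N) ->
  exists G : sgraph, [/\ #|G| = n, circular_arc R G & (d <= sd G)%N].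
Proof.
move=> /andP[T2 Tn] L1 fP dP.
pose g (x : T + 'I_(n - #|T|)) := if x is inl v then f v else (0, 1)%N.
exists (grid_graph L _ g); split.
- by rewrite /= card_sum card_ord subnKC.
- by apply: grid_circular_arc => -[v|i] /=; [exact: fP | split=> //; lia].
apply: (@sd_ge (grid_graph L _ g) [set inl v | v in [set: T]]).
  by rewrite card_imset ?cardsT //; move=> x y [].
move=> _ _ /imsetP[u _ ->] /imsetP[v _ ->] uv.
apply: leq_trans (dP u v _) _; first by apply: contra uv => /eqP ->.
rewrite -(card_imset _ (_ : injective (@inl T 'I_(n - #|T|)))); last by move=> x y [].
apply/subset_leq_card/fintype.subsetP => _ /imsetP[w + ->].
rewrite !inE => /and3P[wu wv wP]; apply/andP; split; first exact: imset_f.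
have inlE (x y : T) : (inl x == inl y :> T + 'I_(n - #|T|)) = (x == y) by [].
by rewrite /= /grid_adj !inlE wu wv.
Qed.

(** The arcs [[i, i + 1]] with [i < 4] form a path, in which a third vertex separates any two. *)
Lemma path4_sd (u v : 'I_4) : u != v ->
  (0 < #|[set w : 'I_4 | [&& w != u, w != v &
     meets 8 (nat_of_ord w, 1%N) (nat_of_ord u, 1%N) (+)
     meets 8 (nat_of_ord w, 1%N) (nat_of_ord v, 1%N)]]|)%N.
Proof.
move=> uv; suff [w w4 wP] : exists2 w, (w < 4)%N & [&& w != u :> nat, w != v :> nat &
    meets 8 (w, 1%N) (nat_of_ord u, 1%N) (+) meets 8 (w, 1%N) (nat_of_ord v, 1%N)].
  by apply/card_gt0P; exists (Ordinal w4); rewrite inE.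
have {uv} : u != v :> nat := uv.
case: (nat_of_ord u) (ltn_ord u) => [|[|[|[|//]]]] _;
  case: (nat_of_ord v) (ltn_ord v) => [|[|[|[|//]]]] _ // _;
  first [by exists 0%N | by exists 1%N | by exists 2%N | by exists 3%N].
Qed.

(** * The family of [8 * k ^ 2] arcs *)

Definition half_arc (k : nat) (v : 'I_(8 * k) * 'I_k) : nat * nat :=
  (val v.1, 3 * k + v.2)%N.
Arguments half_arc k v : clear implicits.

(** [a t] is the start of the arc of length [3 * k + t] with one end at a fixed gap end. It misses
    the arc bounding that gap because two lengths plus one stay below [8 * k]. *)
Lemma half_arc_witness (k : nat) (u v : 'I_(8 * k) * 'I_k) : u != v ->
  exists a : 'I_k -> 'I_(8 * k), forall t,
    meets (8 * k) (half_arc k (a t, t)) (half_arc k u) (+)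
    meets (8 * k) (half_arc k (a t, t)) (half_arc k v).
Proof.
wlog uv1 : u v / (u.1 <= v.1)%N.
  move=> IH uv; have [le|/ltnW le] := leqP u.1 v.1; first exact: IH.
  have [|a aP] := IH v u le; first by rewrite eq_sym.
  by exists a => t; rewrite addbC.
case: u v uv1 => [[i iL] [s sk]] [[j jL] [t tk]] /= ij uv.
have {}uv : (i != j) || (s != t).
  by rewrite -negb_and; apply: contra uv => /andP[/eqP ei /eqP es];
    rewrite -pair_eqE /= -!val_eqE /= ei es !eqxx.
have k0 : (0 < k)%N by lia.
pose wrap x := if (x < 8 * k)%N then x else (x - 8 * k)%N.
suff [a [aL aP]] : exists a : nat -> nat, (forall r, r < k -> a r < 8 * k)%N /\
    forall r, (r < k)%N ->
    meets (8 * k) (a r, 3 * k + r)%N (i, 3 * k + s)%N (+)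
    meets (8 * k) (a r, 3 * k + r)%N (j, 3 * k + t)%N.
  by exists (fun r : 'I_k => Ordinal (aL r (ltn_ord r))) => r; apply: aP (ltn_ord r).
(* Common start: begin one unit past the end of the shorter arc, where the longer one still
   reaches. *)
have [eij|nij] := eqVneq i j.
  have [st|ts] := ltnP s t.
    exists (fun=> wrap (i + 3 * k + s + 1)%N); rewrite /wrap /meets /=;
      split=> r rk; case: ifP; lia.
  exists (fun=> wrap (j + 3 * k + t + 1)%N); rewrite /wrap /meets /=;
    split=> r rk; case: ifP; lia.
(* End at [j - 1], just before [v]; this point lies on [u]. *)
have [c1|c1] := leqP j (i + 3 * k + s + 1).
  exists (fun r => wrap (j + 8 * k - (3 * k + r + 1))%N); rewrite /wrap /meets /=;
    split=> r rk; case: ifP; lia.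
(* Begin just after [u]; even length [3 * k] suffices to reach [j]. *)
have [c2|c2] := leqP j (i + 6 * k + s + 1).
  exists (fun r => wrap (i + 3 * k + s + 1)%N); rewrite /wrap /meets /=;
    split=> r rk; case: ifP; lia.
(* End just before [u], one turn on; [j] is now so late that these arcs contain it. *)
exists (fun r => wrap (i + 8 * k - (3 * k + r + 1))%N); rewrite /wrap /meets /=;
  split=> r rk; case: ifP; lia.
Qed.

Lemma half_arc_sd (k : nat) (u v : 'I_(8 * k) * 'I_k) : u != v ->
  (k - 2 <= #|[set w | [&& w != u, w != v &
     meets (8 * k) (half_arc k w) (half_arc k u) (+)
     meets (8 * k) (half_arc k w) (half_arc k v)]]|)%N.
Proof.
move=> /half_arc_witness[a aP].
pose W := [set (a t, t) | t in [set: 'I_k]].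
have cW : #|W| = k by rewrite card_imset ?cardsT ?card_ord // => x y [].
(* [u] and [v] may themselves belong to [W], which costs 2. *)
apply: (@leq_trans #|W :\ u :\ v|).
  have := cardsD1 u W; have := cardsD1 v (W :\ u); rewrite cW; lia.
apply/subset_leq_card/fintype.subsetP => w; rewrite !inE => /and3P[-> -> /imsetP[t _ ->]].
exact: aP.
Qed.

(** Take the largest [k] with [8 * k ^ 2 <= n]. If [k <= 2] then [n < 72] and the path suffices;
    otherwise [k + 1 <= 4 * (k - 2)] gives [n < 128 * (k - 2) ^ 2]. The bound is rounded up to
    [144 = 12 ^ 2] so that its root is an integer. *)
Lemma circular_arc_sd_ge (R : realType) (n : nat) : (4 <= n)%N ->
  exists G : sgraph, [/\ #|G| = n, circular_arc R G & (n <= 144 * sd G ^ 2)%N].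
Proof.
move=> n4.
have [k kn nk] : exists2 k, (8 * k ^ 2 <= n)%N & (n < 8 * k.+1 ^ 2)%N.
  have ex0 : exists k, (8 * k ^ 2 <= n)%N by exists 0%N.
  have ub k : (8 * k ^ 2 <= n)%N -> (k <= n)%N by nia.
  have [k kn kmax] := ex_maxnP ex0 ub; exists k => //.
  by rewrite ltnNge; apply/negP => /kmax; rewrite ltnn.
have [k2|k2] := leqP k 2.
  have [||||G [Gn cG dG]] := @padded_grid_graph R 8 n 1 'I_4 (fun i => (nat_of_ord i, 1%N)).
  - by rewrite card_ord.
  - by [].
  - by move=> i; split=> //=; rewrite (ltn_trans (ltn_ord i)).
  - exact: path4_sd.
  by exists G; split=> //; nia.
have [||||G [Gn cG dG]] := @padded_grid_graph R (8 * k) n (k - 2) _ (half_arc k).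
- by rewrite card_prod !card_ord; nia.
- by lia.
- by move=> v; have := ltn_ord v.1; have := ltn_ord v.2; rewrite /=; split; lia.
- exact: half_arc_sd.
by exists G; split=> //; nia.
Qed.

Local Open Scope ring_scope.

Theorem theorem5 (R : realType) :
  exists2 c : R, 0 < c &
    forall n : nat, (4 <= n)%N ->
      exists G : sgraph,
        [/\ #|G| = n, circular_arc R G & c * Num.sqrt n%:R <= (sd G)%:R].
Proof.
exists (12%:R^-1); first by rewrite invr_gt0 ltr0n.
move=> n /(circular_arc_sd_ge R)[G [Gn cG nG]]; exists G; split=> //.
rewrite mulrC ler_pdivrMr ?ltr0n // -natrM.
rewrite -(ger0_norm (ler0n R (sd G * 12))) -sqrtr_sqr ler_wsqrtr // -natrX ler_nat.
by rewrite expnMn mulnC.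
Qed.
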